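(* For $k\geq 0$ let $T_k(x)=\sum_{n\geq k+1}\frac{p_n^{n-k}}{(n-1)!}x^n$. Then $T_0(x)=xP(x)$ and for every $k\geq 1$ $$T_k(x)=T_{k-1}(x)+\frac{(k+1)^{k-1}}{k!}x^{k+1}P(x)-\frac{2(k+1)^{k-2}}{(k-1)!}x^k,$$ equivalently $$T_k(x)=P(x)\sum_{i=0}^{k}\frac{(i+1)^{i-1}}{i!}x^{i+1}-\sum_{i=1}^k\frac{2(i+1)^{i-2}}{(i-1)!}x^i.$$
   Context: There are $n$ parking spaces in a line numbered $1,\dots,n$; $n$ cars arrive in order, car $j$ has preference $a_j\in[n]$ and parks in the first unoccupied space numbered $\geq a_j$, if any; $(a_1,\dots,a_n)$ is a parking function if all cars park. $p_n^l$ is the number of parking functions $(a_1,\dots,a_n)$ of length $n$ with $a_1=l$. $P(x)=\sum_{n\geq 0}\frac{(n+1)^{n-1}}{n!}x^n$. *)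

(* Defs.v *)
From mathcomp Require Import all_boot all_order all_algebra.

Set Implicit Arguments.
Unset Strict Implicit.
Unset Printing Implicit Defensive.

Import GRing.Theory Num.Theory.
Local Open Scope ring_scope.

(* Spaces are numbered 1, ..., n; [occ] lists the occupied ones. *)
Definition first_free (n : nat) (occ : seq nat) (a : nat) : option nat :=
  ohead [seq s <- iota a (n.+1 - a) | s \notin occ].

Fixpoint all_park (n : nat) (occ : seq nat) (prefs : seq nat) : bool :=
  if prefs is a :: prefs' then
    if first_free n occ a is Some s then all_park n (s :: occ) prefs'
    else false
  else true.

(* Preferences live in [n] = {1, ..., n}: the ordinal i : 'I_n encodes the
   space numbered i + 1. *)
Definition prefs (n : nat) (a : n.-tuple 'I_n) : seq nat :=
  [seq (val i).+1 | i <- a].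

Definition parking_function (n : nat) (a : n.-tuple 'I_n) : bool :=
  all_park n [::] (prefs a).

(* The default value 0 of [head] is only used for n = 0. *)
Definition pf_first (n l : nat) : nat :=
  #|[set a : n.-tuple 'I_n | parking_function a & head 0%N (prefs a) == l]|.

(* Formal power series over the rationals, as coefficient sequences; equality
   of series is therefore [=1]. *)
Definition fps : Type := nat -> rat.

Declare Scope fps_scope.
Delimit Scope fps_scope with fps.
Bind Scope fps_scope with fps.

Definition fps_add (f g : fps) : fps := fun n => f n + g n.
Definition fps_sub (f g : fps) : fps := fun n => f n - g n.
Definition fps_mul (f g : fps) : fps :=
  fun n => \sum_(i < n.+1) f i * g (n - i)%N.
Definition fps_of_poly (p : {poly rat}) : fps := fun n => p`_n.
Arguments fps_of_poly p%_ring_scope.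

Notation "f + g" := (fps_add f g) : fps_scope.
Notation "f - g" := (fps_sub f g) : fps_scope.
Notation "f * g" := (fps_mul f g) : fps_scope.

(* The exponents n - 1 here and k - 2 in the theorem may be negative, hence
   integer powers. *)
Definition P : fps := fun n => n.+1%:R ^ (n%:Z - 1) / n`!%:R.

Definition T (k : nat) : fps :=
  fun n => if (k.+1 <= n)%N then (pf_first n (n - k))%:R / (n.-1)`!%:R else 0.

(* Main.v *)
Require Import Defs.
From mathcomp Require Import all_boot all_order all_algebra.
From mathcomp Require Import zify ring.

Import GRing.Theory Num.Theory.
Local Open Scope ring_scope.

(* A sequence of preferences parks iff, for every i <= n, at least i of them are
   at most i; this only depends on the histogram h of the preferences, and says
   that the path starting at height 1 with steps h_i - 1 stays positive. For paths
   starting at height x, summing over the first entry of h gives by induction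
   x (x + m)^(m - 1) words of length m with such a histogram (an Abel-type
   identity, here a consequence of the binomial theorem): x = 1 counts parking
   functions, and x = 2 counts those with a_1 = 1. Replacing a_1 = l by l + 1
   destroys the parking property exactly when the other cars split into a parking
   function on the spaces before l and one on the spaces after l, so that
   p_n^l - p_n^(l+1) = C(n-1, l-1) l^(l-2) (n-l+1)^(n-l-1). *)

(** * Parking as a counting condition on preferences *)

Lemma count_leq_uniq_full (n : nat) (occ : seq nat) (i : nat) :
  uniq occ -> {subset occ <= iota 1 n} -> size occ = n -> (i <= n)%N ->
  count (fun y => (y <= i)%N) occ = i.
Proof.
move=> Uocc sub szo le_in.
have [_ eqo] := uniq_min_size Uocc sub (eq_leq (etrans (size_iota 1 n) (esym szo))).
have /permP -> : perm_eq occ (iota 1 n) by apply: uniq_perm => //; exact: iota_uniq.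
rewrite -{1}(subnKC le_in) iotaD count_cat.
have -> : count (fun y => (y <= i)%N) (iota 1 i) = i.
  rewrite -[RHS](size_iota 1 i); apply/eqP; rewrite -all_count.
  by apply/allP => y; rewrite mem_iota; lia.
rewrite (_ : count _ (iota (1 + i) _) = 0%N) ?addn0 //.
by apply/eqP; rewrite eqn0Ngt -has_count; apply/hasPn => y; rewrite mem_iota; lia.
Qed.

(** The run injects into the entries of [occ] lying in it. The case i = a - 1 is an empty run. *)
Lemma count_leq_run (occ : seq nat) (a i : nat) :
  (0 < a)%N -> (a.-1 <= i)%N -> (forall y, (a <= y <= i)%N -> y \in occ) ->
  (count (fun y => (y <= a.-1)%N) occ + (i - a.-1) <=
    count (fun y => (y <= i)%N) occ)%N.
Proof.
move=> a0 ai run.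
pose q := fun y => (a <= y <= i)%N.
have -> : count (fun y => (y <= i)%N) occ =
    (count (fun y => (y <= a.-1)%N) occ + count q occ)%N.
  rewrite -count_predUI [X in (_ + X)%N](_ : _ = 0%N) ?addn0.
    by apply: eq_count => y /=; rewrite /q; lia.
  by apply/eqP; rewrite eqn0Ngt -has_count; apply/hasPn => y _ /=; rewrite /q; lia.
rewrite leq_add2l -size_filter -[leqLHS](size_iota a).
apply: uniq_leq_size; first exact: iota_uniq.
move=> y; rewrite mem_iota mem_filter => Hy.
have Hq : q y by rewrite /q; lia.
by rewrite Hq; apply: run.
Qed.

Variant first_free_spec (n : nat) (occ : seq nat) (a : nat) : option nat -> Set :=
  | FirstFree s of (a <= s <= n)%N & s \notin occ
      & (forall y, (a <= y < s)%N -> y \in occ) : first_free_spec n occ a (Some s)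
  | NoFree of (forall y, (a <= y <= n)%N -> y \in occ) : first_free_spec n occ a None.

Lemma first_freeP (n : nat) (occ : seq nat) (a : nat) :
  first_free_spec n occ a (first_free n occ a).
Proof.
rewrite /first_free; move Ek: (n.+1 - a)%N => k.
elim: k a Ek => [|k IH] a Ek /=; first by constructor => y; lia.
case: ifP => [nocc|/negbFE aocc] /=.
  by constructor => // [|y]; lia.
have /IH : (n.+1 - a.+1 = k)%N by lia.
case=> [s Hs ns run|run]; constructor => //; try lia.
  by move=> y Hy; have [->//|ne] := eqVneq y a; apply: run; lia.
by move=> y Hy; have [->//|ne] := eqVneq y a; apply: run; lia.
Qed.

(* The right-hand side is invariant when the next car parks: if it is shifted
   from a to s > a, then the spaces a, ..., s - 1 are all occupied. *)
Lemma all_park_countP (n : nat) (prefs occ : seq nat) :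
  uniq occ -> {subset occ <= iota 1 n} -> {subset prefs <= iota 1 n} ->
  (size occ + size prefs)%N = n ->
  reflect (forall i, (i <= n)%N ->
    (i <= count (fun y => y <= i) occ + count (fun y => y <= i) prefs)%N)
    (all_park n occ prefs).
Proof.
elim: prefs occ => [|a p IH] occ Uo So Sp sz.
  apply: (iffP idP) => //= _ i le_in.
  by rewrite addn0 (@count_leq_uniq_full n) // -sz addn0.
have /Sp : a \in a :: p by rewrite inE eqxx.
rewrite mem_iota => a_in.
have Sp' : {subset p <= iota 1 n} by move=> y yp; apply: Sp; rewrite inE yp orbT.
rewrite /=; case: first_freeP => [s Hs ns run|run].
  have /IH {}IH : uniq (s :: occ) by rewrite /= ns.
  have /IH {}IH : {subset s :: occ <= iota 1 n}.
    by move=> y; rewrite inE => /predU1P[->|/So//]; rewrite mem_iota; lia.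
  have {IH} /= IH := IH Sp' ltac:(by move: sz => /=; lia).
  apply: (iffP IH) => H i le_in; first by have := H i le_in; case: (leqP s i); lia.
  have := H i le_in; case: (leqP s i) => [|lt_is]; first by lia.
  case: (leqP a i) => [le_ai|]; last by lia.
  have := @count_leq_run occ a i ltac:(lia) ltac:(lia) ltac:(move=> y Hy; apply: run; lia).
  have := H a.-1 ltac:(lia).
  have : (count (fun y => y <= a.-1) p <= count (fun y => y <= i) p)%N.
    by apply: sub_count => y /=; lia.
  have : (a <= a.-1)%N = false by lia.
  by move=> ->; lia.
apply: (iffP idP) => // H.
(* With a, ..., n all occupied, the condition at a - 1 would force n cars among [occ] and [p], but
   there are only n - 1. *)
have := @count_leq_run occ a n ltac:(lia) ltac:(lia) run.
have := H a.-1 ltac:(lia).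
have : (count (fun y => y <= a.-1) p <= size p)%N by exact: count_size.
have : (count (fun y => y <= n) occ <= size occ)%N by exact: count_size.
have : (a <= a.-1)%N = false by lia.
by move: sz => /= sz ->; lia.
Qed.

(** * Weighted enumeration of histograms *)

(* Sum over the histograms h of length n and total m satisfying Phi of the
   products of the 1 / h_i!: this is 1 / m! times the number of words of length
   m on n letters whose histogram satisfies Phi. *)
Fixpoint hsum (n m : nat) (Phi : pred (seq nat)) : rat :=
  if n is n'.+1 then
    \sum_(j < m.+1) (j`!%:R)^-1 * hsum n' (m - j) (fun h => Phi (nat_of_ord j :: h))
  else ((m == 0%N) && Phi [::])%:R.

Lemma hsum_recl (n m : nat) (Phi : pred (seq nat)) :
  hsum n.+1 m Phi =
  \sum_(j < m.+1) (j`!%:R)^-1 * hsum n (m - j) (fun h => Phi (nat_of_ord j :: h)).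
Proof. by []. Qed.

Lemma eq_hsum (n m : nat) (Phi Psi : pred (seq nat)) :
  (forall h, size h = n -> Phi h = Psi h) -> hsum n m Phi = hsum n m Psi.
Proof.
elim: n m Phi Psi => [|n IH] m Phi Psi eqP /=; first by rewrite eqP.
by apply: eq_bigr => j _; congr (_ * _); apply: IH => h sh; apply: eqP; rewrite /= sh.
Qed.

Lemma hsum_pred0 (n m : nat) : hsum n m pred0 = 0.
Proof.
elim: n m => [|n IH] m /=; first by rewrite andbF.
by rewrite big1 // => j _; rewrite IH mulr0.
Qed.

Lemma factVS (j : nat) : (j.+1%:R : rat) * (j.+1`!%:R)^-1 = (j`!%:R)^-1.
Proof. by rewrite factS natrM invfM mulVKf // pnatr_eq0. Qed.

(* Leibniz rule for the product of n exponentials. *)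
Lemma hsumS (n m : nat) (Phi : pred (seq nat)) :
  m.+1%:R * hsum n m.+1 Phi =
  \sum_(v < n) hsum n m (fun h => Phi (incr_nth h v)).
Proof.
elim: n m Phi => [|n IH] m Phi; first by rewrite big_ord0 /= mulr0.
rewrite big_ord_recl [hsum n.+1 m.+1 _]/= mulr_sumr.
rewrite (eq_bigr (fun j : 'I_m.+2 =>
    (j%:R * (j`!%:R)^-1) * hsum n (m.+1 - j) (fun h => Phi (nat_of_ord j :: h))
  + (j`!%:R)^-1 * ((m.+1 - j)%:R * hsum n (m.+1 - j) (fun h => Phi (nat_of_ord j :: h)))));
  last first.
  move=> j _; have -> : m.+1%:R = j%:R + (m.+1 - j)%:R :> rat.
    by rewrite -natrD subnKC // -ltnS.
  by ring.
rewrite big_split /=; congr (_ + _).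
  rewrite big_ord_recl !mul0r add0r; apply: eq_bigr => j _.
  by rewrite lift0 factVS subSS.
rewrite big_ord_recr /= subnn mul0r mulr0 addr0.
under eq_bigr => j _.
  rewrite subSn; last by rewrite -ltnS.
  rewrite IH mulr_sumr.
  over.
by rewrite exchange_big.
Qed.

Definition histogram (n : nat) (s : seq nat) : seq nat :=
  foldr (fun v h => incr_nth h v) (nseq n 0%N) s.

Lemma size_histogram (n : nat) (s : seq nat) :
  all (fun v => (v < n)%N) s -> size (histogram n s) = n.
Proof.
elim: s => [|v s IH] /=; first by rewrite size_nseq.
by case/andP=> vn /IH szs; rewrite size_incr_nth szs vn.
Qed.

Lemma sumn_take_incr_nth (h : seq nat) (v i : nat) :
  (v < size h)%N -> sumn (take i (incr_nth h v)) = ((v < i) + sumn (take i h))%N.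
Proof.
elim: h v i => [|j h IH] [|v] [|i] //= vh.
by rewrite IH // ltnS; lia.
Qed.

Lemma sumn_take_histogram (n : nat) (s : seq nat) (i : nat) :
  all (fun v => (v < n)%N) s ->
  sumn (take i (histogram n s)) = count (fun v => (v < i)%N) s.
Proof.
elim: s => [|v s IH] /=.
  by move=> _; rewrite /histogram /=; elim: n i => [|n IH] [|i] //=; exact: IH.
case/andP=> vn sn; rewrite sumn_take_incr_nth ?IH //.
by rewrite size_histogram.
Qed.

Lemma big_tuple_cons (R : nmodType) (T : finType) (m : nat) (F : seq T -> R) :
  \sum_(t : m.+1.-tuple T) F t = \sum_(v : T) \sum_(t : m.-tuple T) F (v :: t).
Proof.
rewrite pair_bigA /=.
rewrite (reindex (fun p : T * m.-tuple T => [tuple of p.1 :: p.2])) //=.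
exists (fun t : m.+1.-tuple T => (thead t, [tuple of behead t])) => [[v t]|t] _ /=.
  by congr (_, _); apply: val_inj.
by rewrite [RHS]tuple_eta; apply: val_inj.
Qed.

(** Removing the first letter v replaces [Phi] by its composition with [incr_nth] at v, which is the
    recursion [hsumS]. *)
Lemma sum_tuple_histogram (n m : nat) (Phi : pred (seq nat)) :
  \sum_(t : m.-tuple 'I_n) (Phi (histogram n (map val t)))%:R =
  m`!%:R * hsum n m Phi.
Proof.
elim: m Phi => [|m IH] Phi.
  rewrite fact0 mul1r (big_pred1 [tuple]) /=; last by move=> t; apply/esym/eqP; exact: tuple0.
  rewrite /histogram /=; elim: n Phi => [|n IHn] Phi //=.
  by rewrite big_ord_recl big_ord0 addr0 invr1 mul1r -IHn.
rewrite (@big_tuple_cons _ _ _ (fun t : seq 'I_n => (Phi (histogram n (map val t)))%:R)).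
rewrite factS mulnC natrM -mulrA hsumS mulr_sumr; apply: eq_bigr => v _.
by rewrite -IH.
Qed.

(** * Ballot histograms *)

(* The path starting at height x with steps h_i - 1 stays positive. *)
Fixpoint ballot (x : nat) (h : seq nat) : bool :=
  (0 < x)%N && (if h is j :: h' then ballot (x + j).-1 h' else true).

Lemma ballot0 (h : seq nat) : ballot 0 h = false.
Proof. by case: h. Qed.

Lemma hsum_ballot_start0 (n m : nat) : hsum n m (ballot 0) = 0.
Proof. by rewrite -(hsum_pred0 n m); apply: eq_hsum => h _; rewrite ballot0. Qed.

Lemma ballotP (x : nat) (h : seq nat) :
  reflect (forall i, (i <= size h)%N -> (i < x + sumn (take i h))%N) (ballot x h).
Proof.
elim: h x => [|j h IH] x /=.
  apply: (iffP idP) => [x0 [|i]//= _|/(_ 0%N)]; rewrite ?andbT ?addn0 //; lia.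
case: x => [|x] /=; first by constructor => /(_ 0%N isT).
apply: (iffP (IH _)) => H i le_i; last by have /= := H i.+1 le_i; lia.
by case: i le_i => [|i] //= le_i; have := H i le_i; lia.
Qed.

Lemma sum_exprn_fact (m : nat) (y : rat) :
  \sum_(j < m.+1) (j`!%:R)^-1 * (y ^+ (m - j) / (m - j)`!%:R) =
  (1 + y) ^+ m / m`!%:R.
Proof.
rewrite addrC exprDn mulr_suml; apply: eq_bigr => j _.
have jm : (j <= m)%N by rewrite -ltnS.
rewrite -(bin_fact jm) expr1n mulr1 !natrM -mulr_natr.
have Cn0 : 'C(m, j)%:R != 0 :> rat by rewrite pnatr_eq0 -lt0n bin_gt0.
have f0 k : k`!%:R != 0 :> rat by rewrite pnatr_eq0 -lt0n fact_gt0.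
by field; rewrite Cn0 !f0.
Qed.

(** With k = m - j, the inner factor is y^k / k! - y^(k-1) / (k-1)!, the second term being 0 for k =
    0; each half sums by the binomial theorem. *)
Lemma abel_sum (m : nat) (y : rat) : y != 0 -> 1 + y != 0 ->
  \sum_(j < m.+1) (j`!%:R)^-1 * ((y - (m - j)%:R) * y ^ ((m - j)%:Z - 1) / (m - j)`!%:R)
  = (1 + y - m%:R) * (1 + y) ^ (m%:Z - 1) / m`!%:R.
Proof.
move=> y0 y10; have predexp (z : rat) k : z != 0 -> z * z ^ (k%:Z - 1) = z ^+ k.
  by move=> z0; rewrite -{1}[z]expr1z -expfzDr // addrC subrK.
rewrite (eq_bigr (fun j : 'I_m.+1 => (j`!%:R)^-1 * (y ^+ (m - j) / (m - j)`!%:R) -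
   (j`!%:R)^-1 * ((m - j)%:R / (m - j)`!%:R * y ^ ((m - j)%:Z - 1)))); last first.
  by move=> j _; rewrite -(predexp y (m - j)%N y0); set z := y ^ _; ring.
rewrite big_split /= sum_exprn_fact sumrN [in RHS]mulrBl predexp // [RHS]mulrBl.
congr (_ - _); case: m => [|m].
  by rewrite big_ord_recl big_ord0 /= !mul0r mulr0 addr0.
rewrite big_ord_recr /= subnn !mul0r mulr0 addr0.
rewrite (_ : m.+1%:Z - 1 = m%:Z); last by lia.
rewrite mulrAC factVS mulrC -sum_exprn_fact; apply: eq_bigr => j _.
rewrite subSn; last by rewrite -ltnS.
rewrite factVS (_ : (m - j).+1%:Z - 1 = (m - j)%N%:Z); last by lia.
by congr (_ * _); rewrite mulrC.
Qed.

(** The hypothesis says that the path ends at height 1. *)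
Lemma hsum_ballot (n m x : nat) : n.+1 = (x + m)%N ->
  hsum n m (ballot x) = x%:R * (x + m)%:R ^ (m%:Z - 1) / m`!%:R.
Proof.
elim: n m x => [|n IH] m [|x] Exm.
- by rewrite /= andbF !mul0r.
- have [-> ->] : x = 0%N /\ m = 0%N by lia.
  by rewrite /= exp1rz.
- by rewrite !mul0r hsum_ballot_start0.
rewrite /=; have Ey : (x + m)%N = n.+1 by lia.
(* After a first entry j, the height x + j and the m - j remaining letters add up to n + 1, so
   [abel_sum] applies with y = n + 1. *)
rewrite (eq_bigr (fun j : 'I_m.+1 => (j`!%:R)^-1 *
   ((n.+1%:R - (m - j)%:R) * n.+1%:R ^ ((m - j)%:Z - 1) / (m - j)`!%:R))); last first.
  move=> j _; have jm := ltn_ord j; congr (_ * _).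
  rewrite IH; last by lia.
  rewrite (_ : (x + j + (m - j))%N = n.+1); last by lia.
  by rewrite -natrB; [congr (_%:R * _ / _)|]; lia.
rewrite abel_sum ?nat1r ?pnatr_eq0 // -Exm -natrB; last by lia.
by congr (_%:R * _ / _); lia.
Qed.

(* [ballot x (incr_nth h l)], except that it is false if l is out of range, where
   [incr_nth] would extend h. *)
Fixpoint ballot_incr (l x : nat) (h : seq nat) {struct h} : bool :=
  if h is j :: h' then
    (0 < x)%N && (if l is l'.+1 then ballot_incr l' (x + j).-1 h' else ballot (x + j) h')
  else false.

Lemma ballot_incrE (l x : nat) (h : seq nat) :
  (l < size h)%N -> ballot_incr l x h = ballot x (incr_nth h l).
Proof.
elim: h l x => [|j h IH] [|l] x //= lh; first by rewrite addnS.
by rewrite IH.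
Qed.

Lemma hsum_ballot_incr_start0 (n m l : nat) : hsum n m (ballot_incr l 0) = 0.
Proof. by rewrite -(hsum_pred0 n m); apply: eq_hsum => -[]. Qed.

Lemma ballot_incr_oversize (l x : nat) (h : seq nat) :
  (size h <= l)%N -> ballot_incr l x h = false.
Proof.
by elim: h l x => [|j h IH] [|l] x //= lh; rewrite IH ?andbF.
Qed.

(* Moving the additional letter from l to l + 1 is harmful only if the path
   would hit 0 right after the letter l, which splits it into two paths. *)
Lemma hsum_ballot_incr (l r m x : nat) : (l.+1 + r)%N = (x + m)%N ->
  hsum (l.+1 + r) m (ballot_incr l x) =
  hsum (l.+1 + r) m (ballot_incr l.+1 x) +
  (if (r <= m)%N then hsum l (m - r) (ballot x) * hsum r r (ballot 1) else 0).
Proof.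
elim: l m x => [|l IH] m [|x] Exm.
- by rewrite !hsum_ballot_incr_start0 hsum_ballot_start0 mul0r if_same addr0.
- rewrite add1n /=.
  have shift j : (0 < x + j)%N -> (0 < r)%N ->
      hsum r (m - j) (fun h => ballot (x.+1 + j) h) =
      hsum r (m - j) (fun h => ballot_incr 0 (x.+1 + j).-1 h).
    move=> xj r0; apply: eq_hsum => -[|a h] /= sz; first by rewrite -sz in r0.
    by rewrite xj.
  (* Here r = x + m, so r <= m means x = 0. Only then does the first entry j = 0 bring the path to 0
     before the moved letter counts. *)
  case: (posnP x) => [x0|x_gt0].
    have rm : r = m by lia.
    rewrite x0 in shift *; rewrite -{}rm in shift *; rewrite leqnn subnn /= mul1r.
    rewrite !big_ord_recl /= subn0 invr1 !mul1r.
    rewrite [X in _ = X + _ + _]hsum_ballot_incr_start0.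
    rewrite add0r addrC; congr (_ + _); apply: eq_bigr => j _.
    by congr (_ * _); apply: shift; have := ltn_ord j; rewrite /bump; lia.
  rewrite (_ : (r <= m)%N = false) ?addr0; last by lia.
  by apply: eq_bigr => j _; congr (_ * _); apply: shift; lia.
- by rewrite !hsum_ballot_incr_start0 hsum_ballot_start0 mul0r if_same addr0.
rewrite [(l.+2 + r)%N]addSn !hsum_recl.
rewrite [X in _ = _ + X]/=.
under [LHS]eq_bigr => j _.
  have jm := ltn_ord j.
  rewrite -[hsum _ _ _]/(hsum (l.+1 + r) (m - j) (ballot_incr l (x + j))).
  rewrite (IH (m - j)%N (x + j)%N); last by lia.
  rewrite mulrDr; over.
rewrite big_split /=; congr (_ + _).
(* The correction terms vanish for j > m - r; the others expand the left path by its first entry. *)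
case: leqP => [le_rm|lt_mr]; last first.
  by rewrite big1 // => j _; rewrite (_ : (r <= m - j)%N = false) ?mulr0 //; lia.
rewrite mulr_suml.
rewrite (@big_ord_widen _ _ _ (m - r).+1 m.+1 (fun j => (j`!%:R)^-1 *
   hsum l (m - r - j) (ballot (x + j)) * hsum r r (ballot 1))); last by lia.
rewrite [RHS]big_mkcond; apply: eq_bigr => j _.
have jm := ltn_ord j.
rewrite (_ : (r <= m - j)%N = (j < (m - r).+1)%N); last by lia.
case: ifP => _; last by rewrite mulr0.
by rewrite mulrA; congr (_ * hsum _ _ _ * _); lia.
Qed.

(** * Counting parking functions *)

(** Letters are preferences minus 1, so the prefix sums of the histogram are the counts in
    [all_park_countP]. *)
Lemma all_park_histogram (n : nat) (s : seq nat) :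
  all (fun v => (v < n)%N) s -> size s = n ->
  all_park n [::] (map S s) = ballot 1 (histogram n s).
Proof.
move=> sn sz; apply/all_park_countP/ballotP => //.
- by move=> y /mapP[v /(allP sn) vn ->]; rewrite mem_iota; lia.
- by rewrite size_map.
- rewrite size_histogram // => H i le_in; have /= := H i le_in.
  by rewrite sumn_take_histogram // count_map.
rewrite size_histogram // => H i le_in; have /= := H i le_in.
by rewrite sumn_take_histogram // count_map.
Qed.

(** The other m cars form an arbitrary word, and [ballot_incr] puts the letter of the first car back
    into its histogram. *)
Lemma pf_first_hsum (m l : nat) : (l <= m)%N ->
  (pf_first m.+1 l.+1)%:R = m`!%:R * hsum m.+1 m (ballot_incr l 1).
Proof.
move=> lm; pose F (s : seq 'I_m.+1) : rat :=
  (all_park m.+1 [::] [seq (val i).+1 | i <- s] &&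
   (head 0%N [seq (val i).+1 | i <- s] == l.+1))%:R.
transitivity (\sum_(t : m.+1.-tuple 'I_m.+1) F t).
  rewrite /pf_first cardsE -sum1_card natr_sum big_mkcond /=.
  apply: eq_bigr => t _; rewrite /F unfold_in /=.
  by rewrite /parking_function /prefs; case: ifP.
rewrite big_tuple_cons (bigD1 (Ordinal (lm : l < m.+1)%N)) //.
rewrite [LHS]/= [X in _ + X = _]big1 ?addr0.
  rewrite -sum_tuple_histogram; apply: eq_bigr => t _.
  have tn : all (fun v => (v < m.+1)%N) (map val t).
    by apply/allP => v /mapP[i _ ->]; exact: ltn_ord.
  rewrite /F /= eqxx andbT ballot_incrE ?size_histogram //.
  rewrite -[incr_nth _ _]/(histogram m.+1 (l :: map val t)) -all_park_histogram /=.
  - by rewrite -map_comp.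
  - by rewrite ltnS lm.
  - by rewrite size_map size_tuple.
move=> v vl; rewrite big1 // => t _; rewrite /F /= eqSS.
by rewrite (negbTE (vl : (v : nat) != l)) andbF.
Qed.

Lemma T_hsum (k m : nat) : (k <= m)%N ->
  T k m.+1 = hsum m.+1 m (ballot_incr (m - k) 1).
Proof.
move=> km; rewrite /T ltnS km subSn // pf_first_hsum ?leq_subr //=.
by rewrite mulrAC divff ?mul1r // pnatr_eq0 -lt0n fact_gt0.
Qed.

Lemma T_small (k n : nat) : (n <= k)%N -> T k n = 0.
Proof. by rewrite /T leqNgt => /negbTE ->. Qed.

Lemma hsum_P (n : nat) : hsum n n (ballot 1) = P n.
Proof. by rewrite hsum_ballot ?add1n // mul1r. Qed.

(** Started at height 1, both halves of the split path are counted by parking functions, whence two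
    coefficients of [P]. *)
Lemma hsum_ballot_incr1 (m l : nat) : (l <= m)%N ->
  hsum m.+1 m (ballot_incr l 1) =
  hsum m.+1 m (ballot_incr l.+1 1) + P l * P (m - l)%N.
Proof.
move=> lm; have E : m.+1 = (l.+1 + (m - l))%N by lia.
rewrite E (@hsum_ballot_incr l (m - l)%N m 1); last by lia.
by rewrite leq_subr subKn // !hsum_P.
Qed.

(** A letter added to the first entry amounts to starting at height 2. *)
Lemma hsum_ballot_incr0 (m : nat) :
  hsum m.+1 m (ballot_incr 0 1) = 2 * m.+2%:R ^ (m%:Z - 1) / m`!%:R.
Proof. by rewrite -[m.+2]/(2 + m)%N -(@hsum_ballot m.+1 m 2). Qed.

(** * Power series *)

Lemma fps_mulZXn (c : rat) (j : nat) (f : fps) (n : nat) :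
  (fps_of_poly (c *: 'X^j) * f)%fps n = if (j <= n)%N then c * f (n - j)%N else 0.
Proof.
rewrite /fps_mul /fps_of_poly; case: leqP => [jn|nj].
  rewrite (bigD1 (Ordinal (jn : (j < n.+1)%N))) //= big1 ?addr0.
    by rewrite coefZ coefXn eqxx mulr1.
  by move=> i ij; rewrite coefZ coefXn (negbTE (ij : (i : nat) != j)) mulr0 mul0r.
rewrite big1 // => i _; have i_lt := ltn_ord i.
by rewrite coefZ coefXn (_ : (i == j :> nat) = false) ?mulr0 ?mul0r //; lia.
Qed.

Lemma fps_mulC (f g : fps) : (f * g)%fps =1 (g * f)%fps.
Proof.
move=> n; rewrite /fps_mul (reindex_inj rev_ord_inj) /=; apply: eq_bigr => i _.
have := ltn_ord i; rewrite mulrC => lt_in.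
by congr (g _ * f _); lia.
Qed.

Lemma fps_mulDr (f : fps) (p q : {poly rat}) (n : nat) :
  (f * fps_of_poly (p + q))%fps n =
  (f * fps_of_poly p)%fps n + (f * fps_of_poly q)%fps n.
Proof.
rewrite /fps_mul /fps_of_poly -big_split; apply: eq_bigr => i _.
by rewrite /= coefD mulrDr.
Qed.

Lemma T0_eq : T 0 =1 (fps_of_poly 'X * P)%fps.
Proof.
move=> n; rewrite -['X]expr1 -[X in fps_of_poly X]scale1r fps_mulZXn mul1r.
case: n => [|m]; first by rewrite T_small.
rewrite T_hsum // subn0 hsum_ballot_incr1 // subnn subSS subn0.
(* The letter m + 1 is out of range, so the difference formula at l = m leaves only P m * P 0. *)
rewrite (@eq_hsum _ _ _ pred0) ?hsum_pred0; last first.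
  by move=> h sz; rewrite ballot_incr_oversize // sz.
by rewrite add0r [P 0]/P exp1rz divr1.
Qed.

Lemma T_rec (k : nat) :
  T k.+1 =1 (T k + fps_of_poly ((k.+2%:R ^ (k.+1%:Z - 1) / k.+1`!%:R) *: 'X^(k.+2)) * P
     - fps_of_poly ((2 * k.+2%:R ^ (k.+1%:Z - 2) / k`!%:R) *: 'X^(k.+1)))%fps.
Proof.
move=> n; rewrite {1}/fps_sub {1}/fps_add fps_mulZXn /fps_of_poly coefZ coefXn.
case: n => [|m]; first by rewrite !T_small //= mulr0 subr0 addr0.
rewrite eqSS ltnS; case: (ltngtP k m) => [km|mk|<-].
- rewrite !T_hsum //; last exact: ltnW.
  rewrite hsum_ballot_incr1 ?leq_subr // subKn // mulr0 subr0 subSS.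
  by rewrite (_ : (m - k.+1).+1 = (m - k)%N) ?[P k.+1 * _]mulrC; [rewrite mulrC|lia].
- by rewrite !T_small ?mulr0 ?subr0 ?addr0 //; lia.
(* At x^(k+1), [T k.+1] has no term, while [T k] counts the parking functions with first preference
   1; the subtracted monomial cancels exactly these. *)
rewrite T_small // T_hsum // subnn hsum_ballot_incr0 addr0 mulr1.
by rewrite (_ : k.+1%:Z - 2 = k%:Z - 1) ?subrr //; lia.
Qed.

Theorem theorem3p8 :
  [/\ T 0 =1 (fps_of_poly 'X * P)%fps,
      forall k : nat, (1 <= k)%N ->
        T k =1 (T k.-1
                + fps_of_poly ((k.+1%:R ^ (k%:Z - 1) / k`!%:R) *: 'X^(k.+1)) * P
                - fps_of_poly
                    ((2 * k.+1%:R ^ (k%:Z - 2) / (k.-1)`!%:R) *: 'X^k))%fps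
    & forall k : nat,
        T k =1 (P * fps_of_poly
                      (\sum_(0 <= i < k.+1)
                         (i.+1%:R ^ (i%:Z - 1) / i`!%:R) *: 'X^(i.+1))
                - fps_of_poly
                    (\sum_(1 <= i < k.+1)
                       (2 * i.+1%:R ^ (i%:Z - 2) / (i.-1)`!%:R) *: 'X^i))%fps].
Proof.
split=> [|[|k] // _|]; [exact: T0_eq | exact: T_rec |].
elim=> [|k IH] n; rewrite {1}/fps_sub.
  rewrite big_nat1 big_geq // exp1rz divr1 scale1r expr1 fps_mulC.
  by rewrite /fps_of_poly coef0 subr0 -T0_eq.
rewrite big_nat_recr // [X in _ - fps_of_poly X _]big_nat_recr //=.
rewrite T_rec fps_mulDr {1}/fps_sub {1}/fps_add IH {1}/fps_sub.
rewrite [X in _ = _ + X - _]fps_mulC /fps_of_poly coefD.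
by ring.
Qed.
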